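(* Let $\Omega_e$ be a curved quadrilateral element, let $N\ge 1$, let $\delta_0,\dots,\delta_N\ge 0$ be real numbers (independent of pseudo-time), and let $u\in\mathbb Q_N(\Omega_e)$. Let $u_\sigma(\hat t)\in\mathbb Q_N(\Omega_e)$, $\hat t\ge0$, be the solution of the initial value problem \[ \frac{d}{d\hat t}\int_{\Omega_e}u_\sigma\,v\,d\bm x+\sum_{m=0}^N\delta_m\int_{\Omega_e}\bigl(u_\sigma-P^{m-1}u_\sigma\bigr)v\,d\bm x=0\quad\forall v\in\mathbb Q_N(\Omega_e),\qquad u_\sigma(0)=u . \] Then, for every $\Delta t\ge 0$, \[ u_\sigma(\Delta t)=P^0u+\sum_{k=1}^N\exp\Bigl(-\Delta t\sum_{m=0}^k\delta_m\Bigr)\bigl(P^ku-P^{k-1}u\bigr). \] In particular $P^0u_\sigma(\Delta t)=P^0u$, i.e. the cell average of $u$ over $\Omega_e$ is preserved exactly.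
   Context: $\Omega_e\subset\mathbb R^2$ is the image of the reference square $[-1,1]^2$ under a smooth invertible map $\bm\Phi^e$ with positive Jacobian determinant. For $m\ge0$, $\mathbb Q_m(\Omega_e)=\{v\in L^2(\Omega_e): v\circ\bm\Phi^e\in\mathbb Q_m([-1,1]^2)\}$, where $\mathbb Q_m([-1,1]^2)$ is the space of polynomials of degree at most $m$ in each of the two variables; hence $\mathbb Q_0(\Omega_e)\subset\mathbb Q_1(\Omega_e)\subset\cdots\subset\mathbb Q_N(\Omega_e)$. $P^m w\in\mathbb Q_m(\Omega_e)$ is the $L^2(\Omega_e)$-projection: $\int_{\Omega_e}(P^mw-w)v\,d\bm x=0$ for all $v\in\mathbb Q_m(\Omega_e)$ (so $P^Nu=u$ for $u\in\mathbb Q_N(\Omega_e)$). By convention $P^{-1}:=P^0$. In the application the $\delta_m$ are damping coefficients computed from the initial datum and frozen during the pseudo-time evolution. *)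

(* Defs.v *)
From mathcomp Require Import all_boot all_order all_algebra.
From mathcomp Require Import all_classical all_reals all_analysis.
Import Order.TTheory GRing.Theory Num.Theory.
Import numFieldNormedType.Exports.

Set Implicit Arguments.
Unset Strict Implicit.
Unset Printing Implicit Defensive.

Local Open Scope classical_set_scope.
Local Open Scope ring_scope.

Section CurvedElement.
Context {R : realType}.
Implicit Types (Phi : R * R -> R * R) (m : nat) (u v w p : R * R -> R).

Definition ref_square : set (R * R) := `[-1, 1]%classic `*` `[-1, 1]%classic.

(* C^infinity on the (open) set U: every iterated directional derivative of f,
   of any order (the empty sequence giving f itself), is Frechet differentiable
   at every point of U. *)
Definition smooth_on (U : set (R * R)) (f : R * R -> R * R) : Prop :=
  forall (s : seq (R * R)) (x : R * R), U x ->
    differentiable (foldr (fun d g => 'D_d g) f s) x.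

(* The rows of the Jacobian matrix are indexed by the components .1, .2. *)
Definition jacobian_det Phi (x : R * R) : R :=
  ('D_(1, 0) Phi x).1 * ('D_(0, 1) Phi x).2
  - ('D_(0, 1) Phi x).1 * ('D_(1, 0) Phi x).2.

(* Smoothness on the closed square means smoothness on an open neighbourhood;
   invertibility (onto the image) and positivity of the Jacobian are only
   required on the square.  The values of Phi off the square play no role. *)
Record element_map Phi : Prop := ElementMap {
  element_map_smooth :
    exists U : set (R * R), [/\ open U, ref_square `<=` U & smooth_on U Phi] ;
  element_map_inj : set_inj ref_square Phi ;
  element_map_jac : forall x, ref_square x -> 0 < jacobian_det Phi x }.

Definition element Phi : set (R * R) := Phi @` ref_square.

Definition leb2 : {measure set (measurableTypeR R * measurableTypeR R) -> \bar R} :=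
  (@lebesgue_measure R \x @lebesgue_measure R)%E.

Definition integ Phi (f : R * R -> R) : R :=
  Rintegral leb2 (element Phi) f.

(* Functions on the element are represented by functions on the plane, whose
   values off the element are irrelevant. *)
Definition L2 Phi v : Prop := v \_ (element Phi) \in Lfun leb2 2%:E.

Definition tensor_poly m (c : 'M[R]_m.+1) (x : R * R) : R :=
  \sum_(i < m.+1) \sum_(j < m.+1) c i j * x.1 ^+ i * x.2 ^+ j.

Definition Qspace Phi m v : Prop :=
  L2 Phi v /\
  exists c : 'M[R]_m.+1, forall x, ref_square x -> v (Phi x) = tensor_poly c x.

Definition is_L2proj Phi m w p : Prop :=
  Qspace Phi m p /\
  forall v, Qspace Phi m v -> integ Phi (fun x => (p x - w x) * v x) = 0.

(* "The" projection: such a p is unique on the element, and xget selects one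
   (up to its irrelevant values off the element). *)
Definition L2proj Phi m w : R * R -> R :=
  xget (fun=> 0) [set p | is_L2proj Phi m w p].

(* F'(t) = l for F considered on [0, +oo[: two-sided derivative if t > 0,
   right derivative if t = 0. *)
Definition halfline_derivative (F : R -> R) (t l : R) : Prop :=
  h^-1 * (F (t + h) - F t) @[h --> within [set h | 0 <= t + h] (0 : R)^'] --> l.

(* The index m.-1 encodes the convention P^(-1) := P^0, as 0.-1 = 0. *)
Definition is_damping_solution Phi (N : nat) (delta : nat -> R) u
    (us : R -> R * R -> R) : Prop :=
  [/\ forall t, 0 <= t -> Qspace Phi N (us t),
      forall v, Qspace Phi N v -> forall t, 0 <= t ->
        exists2 d : R,
          halfline_derivative (fun s => integ Phi (fun x => us s x * v x)) t d
          & d + \sum_(0 <= m < N.+1) delta m *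
              integ Phi (fun x => (us t x - L2proj Phi m.-1 (us t) x) * v x) = 0
    & forall x, element Phi x -> us 0 x = u x].

Definition cell_average Phi w : R :=
  integ Phi w / fine (leb2 (element Phi)).

End CurvedElement.

(* Main.v *)
Require Import Defs.
From mathcomp Require Import all_boot all_order all_algebra.
From mathcomp Require Import all_classical all_reals all_analysis.
From mathcomp Require Import measurable_realfun ring lra.
Import Order.TTheory GRing.Theory Num.Theory.
Import numFieldNormedType.Exports.

Set Implicit Arguments.
Unset Strict Implicit.
Unset Printing Implicit Defensive.

Local Open Scope classical_set_scope.
Local Open Scope ring_scope.

(** The increments [P^k w - P^(k-1) w] diagonalise the damping operator: tested
against such an increment (of any [w]), the term [us - P^(m-1) us] gives
[<us, P^k w - P^(k-1) w>] when [1 <= k] and [m <= k], and [0] otherwise.  Each of these scalar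
products hence solves a linear scalar equation on the half-line, and
self-adjointness of the projections moves the increments from the test
function onto [u].

Existence of the projections and equality of functions everywhere (not just
almost everywhere) on the element need a nonnegative continuous integrand with
zero integral to vanish identically.  This holds because [Phi], being injective
with nonvanishing Jacobian, maps small boxes onto sets with nonempty interior. *)

(** * Borel sets of the plane *)

(** Each point of an open set lies in a rational box contained in the set, so countably many boxes
    cover it; boxes that stick out are replaced by the empty set. *)
Lemma open_measurable_prod (R : realType)
    (A : set (measurableTypeR R * measurableTypeR R)) :
  open (A : set (R * R)) -> measurable A.
Proof.
move=> oA.
pose box (a b c d : rat) : set (R * R) :=
  `]ratr a, ratr b[%classic `*` `]ratr c, ratr d[%classic.
have -> : A = \bigcup_a \bigcup_b \bigcup_c \bigcup_d
    (if `[< box a b c d `<=` A >] then box a b c d else set0).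
  apply/seteqP; split => [[x y] Axy|x [a _ [b _ [c _ [d _]]]]]; last first.
    by case: asboolP => // /[apply].
  move: oA; rewrite openE => /(_ _ Axy) /nbhs_ballP[e /= e0 eA].
  have below z : z - e < z by rewrite ltrBlDr ltrDl.
  have above z : z < z + e by rewrite ltrDl.
  have [a /itvP ax] := rat_in_itvoo (below x).
  have [b /itvP bx] := rat_in_itvoo (above x).
  have [c /itvP cy] := rat_in_itvoo (below y).
  have [d /itvP dy] := rat_in_itvoo (above y).
  exists a => //; exists b => //; exists c => //; exists d => //.
  case: asboolP => [_|[]]; first by rewrite /box/= !in_itv/= ax bx cy dy.
  move=> [z t] []; rewrite /= !in_itv/= => /andP[az zb] /andP[ct td].
  apply: eA; split; rewrite /ball/= ltr_distlC.
    by rewrite (lt_trans _ az) ?(lt_trans zb) ?ax ?bx.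
  by rewrite (lt_trans _ ct) ?(lt_trans td) ?cy ?dy.
do 4 (apply: bigcupT_measurable_rat => ?).
by case: ifPn => // _; apply: measurableX; exact: measurable_itv.
Qed.

Lemma compact_measurable_prod (R : realType)
    (A : set (measurableTypeR R * measurableTypeR R)) :
  compact (A : set (R * R)) -> measurable A.
Proof.
move=> cA; have : closed (A : set (R * R)) by exact: compact_closed.
move=> /closed_openC oA.
rewrite -[A]setCK; apply: measurableC; exact: open_measurable_prod.
Qed.

Lemma leb2_setX (R : realType) (A B : set (measurableTypeR R)) :
  measurable A -> measurable B ->
  leb2 (A `*` B) = (lebesgue_measure A * lebesgue_measure B)%E.
Proof. by move=> mA mB; exact: product_measure1E. Qed.

Lemma compact_leb2_finite (R : realType) (A : set (R * R)) :
  compact A -> (@leb2 R A < +oo)%E.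
Proof.
move=> cA; have [M [_ MA]] := compact_bounded cA.
pose I := `[- (`|M| + 1), `|M| + 1]%classic : set R.
have AI : A `<=` I `*` I.
  move=> [x y] Axy; have := MA (`|M| + 1) _ _ Axy.
  rewrite ltr_pwDr ?ler_norm// => /(_ isT).
  move=> h; split; rewrite /I /= in_itv/= -ler_norml.
    by apply: le_trans h; rewrite le_max lexx.
  by apply: le_trans h; rewrite le_max lexx orbT.
have mI : measurable (I : set (measurableTypeR R)) by exact: measurable_itv.
apply: (@le_lt_trans _ _ (@leb2 R (I `*` I))).
  apply: le_measure; rewrite ?inE//; first exact: compact_measurable_prod.
  exact: measurableX.
rewrite leb2_setX// lebesgue_measure_itv/= lte_fin.
by case: ifP => _; rewrite -?EFinB -?EFinM ?ltry// mule0.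
Qed.

(** * A scalar equation on the half-line *)

(* The factor exp (l t) turns the equation into the vanishing of a derivative. *)
Lemma halfline_linear_ode (R : realType) (F : R -> R) (l : R) :
  (forall t : R, 0 <= t -> halfline_derivative F t (- l * F t)) ->
  forall t : R, 0 <= t -> F t = expR (- (t * l)) * F 0.
Proof.
move=> dF t; rewrite le_eqVlt => /predU1P[<-|t0].
  by rewrite mul0r oppr0 expR0 mul1r.
pose G (s : R) : R := F s * expR (s * l).
have dF1 (s : R) : 0 < s -> is_derive s 1 F (- l * F s).
  move=> s0; have := dF s (ltW s0); rewrite /halfline_derivative => cF.
  have {}cF : h^-1 *: (F (h *: 1 + s) - F s) @[h --> 0^'] --> - l * F s.
    (* Since [s] is positive, the half-line constraint holds for all small increments, so the
       restricted limit is the two-sided one. *)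
    have D : \forall h \near (0 : R)^', 0 <= s + h.
      apply/nbhs_ballP; exists s => //= h.
      rewrite /ball/= sub0r normrN ltr_norml => /andP[hs _] _.
      by rewrite -lerBlDl sub0r ltW.
    move=> A /cF; rewrite /within/= /nbhs/=; apply: filterS2 D.
    by move=> h /= hs /(_ hs); rewrite [h *: 1]mulr1 [h + s]addrC.
  apply: DeriveDef; first by apply/cvg_ex; exists (- l * F s).
  exact: cvg_lim cF.
have dG (s : R) : 0 < s -> is_derive s 1 G 0.
  move=> s0; have := dF1 _ s0 => Fs.
  have eqG : 0 = F s *: (expR (s * l) * l) + expR (s * l) *: (- l * F s).
    by rewrite /GRing.scale/=; ring.
  rewrite eqG; apply: is_deriveM.
  apply: (@is_derive1_comp _ expR (fun s => s * l)).
  by apply: is_derive_eq; rewrite scaler0 add0r [l%:A]mulr1.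
(* The right difference quotient converges at [0]; multiplied by the increment, it yields the right
   continuity that the mean value theorem needs at the endpoint. *)
have F0 : F h @[h --> 0^'+] --> F 0.
  have c0 : h^-1 * (F h - F 0) @[h --> 0^'+] --> - l * F 0.
    move=> A nA; have dA : nbhs (0 : R) (fun h => h != 0 -> 0 <= 0 + h ->
      A (h^-1 * (F (0 + h) - F 0))) := dF 0 (lexx 0) A nA.
    suff : nbhs (0 : R) (fun h => 0 < h -> A (h^-1 * (F h - F 0))) by [].
    move/nbhs_ballP: dA => [e e0 eA].
    apply/nbhs_ballP; exists e => // h /eA + h0; rewrite add0r; apply.
      by rewrite gt_eqF.
    exact: ltW.
  have ch : h @[h --> 0^'+] --> (0 : R).
    by apply: (@cvg_at_right_filter _ _ id (0 : R) (0 : R)); exact: cvg_id.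
  have cF : h * (h^-1 * (F h - F 0)) + F 0 @[h --> 0^'+] --> 0 * (- l * F 0) + F 0.
    by apply: cvgD; [exact: (cvgM ch c0)|exact: cvg_cst].
  rewrite mul0r add0r in cF; apply: cvg_trans cF; apply: near_eq_cvg.
  have ne0 : \forall h \near (0 : R)^'+, h != 0 by exact: nbhs_right_neq.
  by apply: filterS ne0 => h h0; rewrite /= mulrA divff// mul1r subrK.
have cG : {within `[0, t], continuous G}.
  have cE : continuous (fun s : R => expR (s * l)).
    move=> s; apply: continuous_comp; last exact: continuous_expR.
    by apply: cvgMl; exact: cvg_id.
  apply/continuous_within_itvP => //; split.
  - move=> s; rewrite in_itv/= => /andP[s0 _].
    by apply: differentiable_continuous; apply/derivable1_diffP; case: (dG _ s0).
  - by apply: cvgM => //; apply: cvg_at_right_filter; exact: cE.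
  - apply: cvg_at_left_filter.
    by apply: differentiable_continuous; apply/derivable1_diffP; case: (dG _ t0).
have [s|s _] := @MVT R G (fun=> 0) 0 t t0 _ cG.
  by rewrite in_itv/= => /andP[s0 _]; exact: dG.
rewrite mul0r /G mul0r expR0 mulr1 => /eqP; rewrite subr_eq0 => /eqP <-.
by rewrite mulrC -mulrA -expRD subrr expR0 mulr1.
Qed.

(** * Local surjectivity *)

(** Restriction to a line turns directional derivatives into one-variable ones, to which the
    extremum criterion on an interval applies. *)
Lemma is_derive_line (R : realType) (V W : normedModType R) (f : V -> W)
    (x v : V) (t : R) :
  derivable f (t *: v + x) v ->
  is_derive t 1 (fun h : R => f (h *: v + x)) ('D_v f (t *: v + x)).
Proof.
move=> df.
have E : (fun h : R => h^-1 *: (((fun k : R => f (k *: v + x)) \o shift t) (h *: 1)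
            - f (t *: v + x))) =
         (fun h => h^-1 *: ((f \o shift (t *: v + x)) (h *: v) - f (t *: v + x))).
  by apply/funext => h /=; rewrite [h *: 1]mulr1 scalerDl addrA.
by apply: DeriveDef; rewrite /derivable /derive E.
Qed.

Lemma is_derive_fst (R : realType) (V U W : normedModType R) (f : V -> U * W)
    (x v : V) (d : U * W) :
  is_derive x v f d -> is_derive x v (fun z => (f z).1) d.1.
Proof.
case=> df <-.
have c0 : h^-1 *: ((f \o shift x) (h *: v) - f x) @[h --> (0 : R)^'] --> 'D_v f x by exact: df.
have c : (h^-1 *: ((f \o shift x) (h *: v) - f x)).1 @[h --> (0 : R)^'] --> ('D_v f x).1.
  by apply: cvg_comp c0 _; exact: cvg_fst.
apply: DeriveDef; first by apply/cvg_ex; exists ('D_v f x).1.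
exact: cvg_lim c.
Qed.

Lemma is_derive_snd (R : realType) (V U W : normedModType R) (f : V -> U * W)
    (x v : V) (d : U * W) :
  is_derive x v f d -> is_derive x v (fun z => (f z).2) d.2.
Proof.
case=> df <-.
have c0 : h^-1 *: ((f \o shift x) (h *: v) - f x) @[h --> (0 : R)^'] --> 'D_v f x by exact: df.
have c : (h^-1 *: ((f \o shift x) (h *: v) - f x)).2 @[h --> (0 : R)^'] --> ('D_v f x).2.
  by apply: cvg_comp c0 _; exact: cvg_snd.
apply: DeriveDef; first by apply/cvg_ex; exists ('D_v f x).2.
exact: cvg_lim c.
Qed.

(* A minimiser over the closed box of the squared distance from [Phi] to [y]
   is interior when [y] is close to [Phi a]; the gradient of the squared
   distance then vanishes, and as the Jacobian does not, [Phi] hits [y]. *)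
Lemma box_sub_image (R : realType) (Phi : R * R -> R * R) (a : R * R) (r : R) :
  let B := `[a.1 - r, a.1 + r]%classic `*` `[a.2 - r, a.2 + r]%classic in
  0 < r -> (forall x, B x -> differentiable Phi x) ->
  (forall x, B x -> jacobian_det Phi x != 0) -> set_inj B Phi ->
  exists2 d : R, 0 < d &
    `](Phi a).1 - d, (Phi a).1 + d[%classic `*`
    `](Phi a).2 - d, (Phi a).2 + d[%classic `<=` Phi @` B.
Proof.
move=> B r0 dPhi jPhi injPhi.
pose n (y x : R * R) : R := ((Phi x).1 - y.1) ^+ 2 + ((Phi x).2 - y.2) ^+ 2.
have cB : compact B by apply: compact_setX; exact: segment_compact.
have cn y : {within B, continuous (n y)}.
  apply: continuous_in_subspaceT => x; rewrite inE => /dPhi/differentiable_continuous c.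
  have c1 : {for x, continuous (fun z => (Phi z).1)}.
    by apply: continuous_comp c _; exact: cvg_fst.
  have c2 : {for x, continuous (fun z => (Phi z).2)}.
    by apply: continuous_comp c _; exact: cvg_snd.
  apply: cvgD.
    by rewrite expr2; apply: cvgM; apply: cvgB => //; exact: cvg_cst.
  by rewrite expr2; apply: cvgM; apply: cvgB => //; exact: cvg_cst.
pose I := `]a.1 - r, a.1 + r[%classic `*` `]a.2 - r, a.2 + r[%classic.
have oI : open I.
  apply: openI; apply: open_comp; try exact: interval_open.
    by move=> z _; exact: cvg_fst.
  by move=> z _; exact: cvg_snd.
(* On the boundary [S] of the box the distance to [Phi a] has a positive minimum, by injectivity; it
   fixes how close [y] must be. *)
pose S := B `&` ~` I.
have cS : compact S by apply: compact_closedI => //; exact: open_closedC.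
have Ba : B a by rewrite /B/= !in_itv/= !lerBlDr !lerDl ltW.
have S0 : S !=set0.
  exists (a.1 + r, a.2); rewrite /S /B /I/= !in_itv/= ltxx andbF lexx; split; last by case.
  by rewrite !lerBlDr !lerDl -!addrA !lerDl ?addr_ge0 ?ltW.
have [s /set_mem [Bs nIs] mins] := compact_EVT_min S0 cS
  (continuous_subspaceW (@subIsetl _ B (~` I)) (cn (Phi a))).
have ms : 0 < n (Phi a) s.
  rewrite lt_neqAle addr_ge0 ?sqr_ge0// andbT eq_sym paddr_eq0 ?sqr_ge0//.
  rewrite !sqrf_eq0 !subr_eq0; apply/negP => /andP[/eqP e1 /eqP e2].
  have sa : s = a.
    apply: injPhi; rewrite ?inE//.
    by rewrite (surjective_pairing (Phi s)) e1 e2 -surjective_pairing.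
  by apply: nIs; rewrite sa /I/= !in_itv/= !ltrBlDr !ltrDl r0.
(* With the factor 4, images of boundary points have squared distance at least [16 * d ^+ 2] from
   [Phi a], while [y] has at most [2 * d ^+ 2]. *)
pose d := Num.sqrt (n (Phi a) s) / 4.
have d0 : 0 < d by rewrite divr_gt0// sqrtr_gt0.
have dd : 16 * d ^+ 2 = n (Phi a) s.
  by rewrite expr_div_n sqr_sqrtr ?ltW//; field.
exists d => // y [/= + +]; rewrite !in_itv/= => y1 y2.
have ya : n y a <= 2 * d ^+ 2.
  by rewrite /n; move: y1 y2 => /andP[? ?] /andP[? ?]; nra.
have [c /set_mem Bc minc] := compact_EVT_min (ex_intro _ a Ba) cB (cn y).
(* As [n y c <= n y a <= 2 * d ^+ 2], the parallelogram law bounds [n (Phi a) c] by [8 * d ^+ 2],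
   too small for a boundary point. *)
have Ic : I c.
  apply: contrapT => nIc.
  have := minc _ (mem_set Ba); have := mins _ (mem_set (conj Bc nIc)).
  rewrite -dd; move: ya; rewrite /n.
  move: (Phi c) (Phi a) y {y1 y2 minc cn} => [c1 c2] [a1 a2] [z1 z2] /=.
  have := sqr_ge0 (c1 - z1 + (a1 - z1)); have := sqr_ge0 (c2 - z2 + (a2 - z2)).
  have d20 : 0 < d ^+ 2 by exact: exprn_gt0.
  by move: (d ^+ 2) d20 => D; nra.
have grad v : ((Phi c).1 - y.1) * ('D_v Phi c).1 + ((Phi c).2 - y.2) * ('D_v Phi c).2 = 0.
  have lc : {for (0 : R), continuous (fun h : R => h *: v + c)}.
    by apply: cvgD; [apply: cvgZr_tmp; exact: cvg_id|exact: cvg_cst].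
  have : \forall h \near (0 : R), I (h *: v + c).
    by apply: lc; rewrite scale0r add0r; exact: open_nbhs_nbhs.
  move=> /nbhs_ballP[e /= e0 eI].
  have lB h : h \in `]-e, e[ -> B (h *: v + c).
    rewrite in_itv/= => he; have [] := eI h.
      by rewrite /ball/= sub0r normrN ltr_norml.
    by rewrite /B/= !in_itv/= => /andP[? ?] /andP[? ?]; rewrite !ltW.
  pose q (h : R) : R := n y (h *: v + c).
  have dq h : h \in `]-e, e[ -> is_derive h 1 q
      (2 * (((Phi (h *: v + c)).1 - y.1) * ('D_v Phi (h *: v + c)).1 +
            ((Phi (h *: v + c)).2 - y.2) * ('D_v Phi (h *: v + c)).2)).
    move=> /lB/dPhi dP.
    have dl : is_derive h 1 (fun k => Phi (k *: v + c)) ('D_v Phi (h *: v + c)).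
      by apply: is_derive_line; exact: diff_derivable.
    have d1 := is_derive_fst dl; have d2 := is_derive_snd dl.
    have -> : q = ((fun h => (Phi (h *: v + c)).1) - cst y.1) ^+ 2 +
                  ((fun h => (Phi (h *: v + c)).2) - cst y.2) ^+ 2.
      by apply/funext => k; rewrite /q /n !expr2.
    apply: is_derive_eq; rewrite /GRing.scale/= !expr1/= !subr0 [RHS]mulrDr.
    by congr (_ + _); exact: esym (mulrA _ _ _).
  have z0 : (0 : R) \in `]-e, e[ by rewrite in_itv/= oppr_lt0 e0.
  have ee : -e <= e by lra.
  have := derive1_at_min ee (fun t te => @ex_derive _ _ _ _ _ _ _ (dq t te)) z0.
  have qmin t : t \in `]-e, e[ -> q 0 <= q t.
    by move=> te; rewrite /q scale0r add0r; apply: minc; rewrite inE; exact: lB.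
  move=> /(_ qmin) [_ q1]; have [_ q2] := dq 0 z0.
  move: q2; rewrite q1 scale0r add0r => /esym/eqP.
  by rewrite mulf_eq0 pnatr_eq0/= => /eqP.
exists c => //.
have := jPhi _ Bc; rewrite /jacobian_det.
have := grad (1, 0); have := grad (0, 1).
move: ('D_(1, 0) Phi c) ('D_(0, 1) Phi c) => [p1 p2] [q1 q2] /=.
move: (Phi c) y {y1 y2 ya minc grad} => [c1 c2] [z1 z2] /= e1 e2 jac.
(* Cramer's rule: combining the two gradient equations isolates each component of [Phi c - y],
   multiplied by the Jacobian. *)
have f1 : (c1 - z1) * (p1 * q2 - q1 * p2) = 0 by
  transitivity (q2 * ((c1 - z1) * p1 + (c2 - z2) * p2)
    - p2 * ((c1 - z1) * q1 + (c2 - z2) * q2)); [ring|rewrite e1 e2; ring].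
have f2 : (c2 - z2) * (p1 * q2 - q1 * p2) = 0 by
  transitivity (p1 * ((c1 - z1) * q1 + (c2 - z2) * q2)
    - q1 * ((c1 - z1) * p1 + (c2 - z2) * p2)); [ring|rewrite e1 e2; ring].
move/eqP: f1; rewrite mulf_eq0 (negbTE jac) orbF subr_eq0 => /eqP ->.
by move/eqP: f2; rewrite mulf_eq0 (negbTE jac) orbF subr_eq0 => /eqP ->.
Qed.

(** * Integration over the element *)

Lemma compact_ref_square (R : realType) : compact (@ref_square R).
Proof. by apply: compact_setX; exact: segment_compact. Qed.

Lemma continuous_tensor_poly (R : realType) m (c : 'M[R]_m.+1) :
  continuous (tensor_poly c).
Proof.
have cX (f : R * R -> R) n : continuous f -> continuous (fun x => f x ^+ n).
  move=> cf; elim: n => [|n IHn] x; first by under eq_fun do rewrite expr0; exact: cvg_cst.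
  by under eq_fun do rewrite exprS; apply: cvgM; [exact: cf|exact: IHn].
have cS (I : Type) (r : seq I) (F : I -> R * R -> R) :
    (forall i, continuous (F i)) -> continuous (fun x => \sum_(i <- r) F i x).
  move=> cF; elim: r => [|i r IHr] x.
    by under eq_fun do rewrite big_nil; exact: cvg_cst.
  by under eq_fun do rewrite big_cons; apply: cvgD; [exact: cF|exact: IHr].
pose T i j (x : R * R) := c i j * x.1 ^+ i * x.2 ^+ j.
apply: (cS _ _ (fun i x => \sum_j T i j x)) => i.
apply: (cS _ _ (T i)) => j x.
apply: cvgM; last by apply: (cX snd) => y; exact: cvg_snd.
by apply: cvgM; [exact: cvg_cst|apply: (cX fst) => y; exact: cvg_fst].
Qed.

(* A continuous extension of [f \o Phi] to the plane spares continuity within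
   the square. *)
Definition cont_pullback (R : realType) (Phi : R * R -> R * R) (f : R * R -> R) :=
  exists2 g, continuous g & forall x, ref_square x -> f (Phi x) = g x.

Section Element.
Variables (R : realType) (Phi : R * R -> R * R).
Hypothesis hPhi : element_map Phi.
Implicit Types f g v w : R * R -> R.

Let differentiable_Phi x : ref_square x -> differentiable Phi x.
Proof. by case: hPhi => -[U [_ sU smU]] _ _ /sU; exact: (smU [::]). Qed.

(** The closed set [A] is the whole plane for the element itself, and a superlevel set in the proof
    of measurability. *)
Lemma compact_element (A : set (R * R)) : closed A ->
  compact (Phi @` (ref_square `&` A)).
Proof.
move=> cA; apply: continuous_compact.
  apply: continuous_in_subspaceT => x; rewrite inE => -[sx _].
  exact/differentiable_continuous/differentiable_Phi.
by apply: compact_closedI => //; exact: compact_ref_square.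
Qed.

Lemma measurable_element :
  measurable (element Phi : set (measurableTypeR R * measurableTypeR R)).
Proof.
apply: compact_measurable_prod; rewrite /element -[ref_square]setIT.
by apply: compact_element; exact: closedT.
Qed.

Lemma element_finite : (leb2 (element Phi) < +oo)%E.
Proof.
apply: compact_leb2_finite; rewrite /element -[ref_square]setIT.
by apply: compact_element; exact: closedT.
Qed.

Lemma cont_pullbackD f g : cont_pullback Phi f -> cont_pullback Phi g ->
  cont_pullback Phi (fun x => f x + g x).
Proof.
move=> [f1 cf fE] [g1 cg gE]; exists (fun x => f1 x + g1 x).
  by move=> x; apply: cvgD; [exact: cf|exact: cg].
by move=> x sx; rewrite fE// gE.
Qed.

Lemma cont_pullbackM f g : cont_pullback Phi f -> cont_pullback Phi g ->
  cont_pullback Phi (fun x => f x * g x).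
Proof.
move=> [f1 cf fE] [g1 cg gE]; exists (fun x => f1 x * g1 x).
  by move=> x; apply: cvgM; [exact: cf|exact: cg].
by move=> x sx; rewrite fE// gE.
Qed.

Lemma cont_pullback_cst a : cont_pullback Phi (fun=> a).
Proof. by exists (fun=> a) => // x; exact: cvg_cst. Qed.

Lemma cont_pullbackZ a f : cont_pullback Phi f ->
  cont_pullback Phi (fun x => a * f x).
Proof. by move=> cf; apply: cont_pullbackM => //; exact: cont_pullback_cst. Qed.

Lemma cont_pullbackB f g : cont_pullback Phi f -> cont_pullback Phi g ->
  cont_pullback Phi (fun x => f x - g x).
Proof.
move=> cf cg; under eq_fun do rewrite -mulN1r.
by apply: cont_pullbackD => //; exact: cont_pullbackZ.
Qed.

(** Closed half-lines generate the Borel sets, and their preimages in the element are compact, being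
    images under [Phi] of closed subsets of the square. *)
Lemma cont_pullback_measurable f : cont_pullback Phi f ->
  measurable_fun
    (element Phi : set (measurableTypeR R * measurableTypeR R)) f.
Proof.
move=> [g cg fE]; apply: (measurability (@RGenCInfty.G R)) => [|/= _ [_ [a ->] <-]].
  exact: RGenCInfty.measurableE.
 apply: compact_measurable_prod.
rewrite [X in compact X](_ : _ = Phi @` (ref_square `&` g @^-1` `[a, +oo[%classic)).
  apply: compact_element; apply: closed_comp; first by move=> x _; exact: cg.
  exact: interval_closed.
apply/seteqP; split => [_ [[x sx <-]]|_ [x [sx gx] <-]].
  by rewrite /= fE// => gx; exists x.
by split; [exists x|rewrite /= fE].
Qed.

Lemma cont_pullback_bounded f : cont_pullback Phi f ->
  [bounded f x | x in element Phi].
Proof.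
move=> [g cg fE].
have : compact (g @` ref_square).
  by apply: continuous_compact (@compact_ref_square R); exact: continuous_subspaceT.
move=> /compact_bounded[M [_ gM]].
exists M; split; rewrite ?num_real// => y My _ [x sx <-] /=.
by rewrite fE//; apply: gM => //; exists x.
Qed.

Lemma cont_pullback_integrable f : cont_pullback Phi f ->
  (@leb2 R).-integrable (element Phi) (EFin \o f).
Proof.
move=> cf; apply: measurable_bounded_integrable.
- exact: measurable_element.
- exact: element_finite.
- exact: cont_pullback_measurable.
- exact: cont_pullback_bounded.
Qed.

Lemma cont_pullback_L2 f : cont_pullback Phi f -> L2 Phi f.
Proof.
move=> cf; rewrite /L2 inE; apply/andP; split; rewrite inE /=.
  apply/measurable_restrict => //; first exact: measurable_element.
  by rewrite setTI; exact: cont_pullback_measurable.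
rewrite /finite_norm unlock /Lnorm; apply: poweR_lty.
have := integrable_lty measurable_element (cont_pullback_integrable (cont_pullbackM cf cf)).
rewrite integral_mkcond; apply: le_lt_trans.
rewrite le_eqVlt; apply/orP; left; apply/eqP; apply: eq_integral => x _.
rewrite restrict_EFin /= !patchE; case: ifPn => _.
  by rewrite powR_mulrn// -expr2 real_normK// num_real.
by rewrite normr0 powR0// pnatr_eq0.
Qed.

Lemma integD f g : cont_pullback Phi f -> cont_pullback Phi g ->
  integ Phi (fun x => f x + g x) = integ Phi f + integ Phi g.
Proof.
move=> cf cg; apply: RintegralD; first exact: measurable_element.
  exact: cont_pullback_integrable.
exact: cont_pullback_integrable.
Qed.

Lemma integZ a f : cont_pullback Phi f ->
  integ Phi (fun x => a * f x) = a * integ Phi f.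
Proof.
move=> cf; apply: RintegralZl; first exact: measurable_element.
exact: cont_pullback_integrable.
Qed.

Lemma eq_integ f g : (forall x, element Phi x -> f x = g x) ->
  integ Phi f = integ Phi g.
Proof. by move=> fg; apply: eq_Rintegral => x; rewrite inE => /fg. Qed.

(* The image of a small box around a point where [f \o Phi] does not vanish
   contains a box, hence is not negligible. *)
Lemma integ_sqr_eq0 f : cont_pullback Phi f ->
  integ Phi (fun x => f x * f x) = 0 -> forall x, element Phi x -> f x = 0.
Proof.
move=> cf if0; have [g cg fE] := cf.
have cff := cont_pullbackM cf cf.
have iff := cont_pullback_integrable cff.
have : ae_eq (@leb2 R) (element Phi) (EFin \o (fun x => f x * f x)) (cst 0%E).
  apply/ae_eq_integral_abs; first exact: measurable_element.
    by apply/measurable_EFinP; exact: cont_pullback_measurable.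
  have <- : (\int[@leb2 R]_(x in element Phi) (f x * f x)%:E = 0)%E.
    rewrite -[LHS]fineK; first by congr EFin.
    by apply: integrable_fin_num iff; exact: measurable_element.
  by apply: eq_integral => x _ /=; rewrite ger0_norm// -expr2 sqr_ge0.
move=> [N [mN N0 fN]] _ [x sx <-]; rewrite fE//.
apply: contrapT => /eqP gx0.
(* The point may lie on the boundary of the square; shrinking it slightly towards the origin makes
   it interior and, by continuity, keeps [g] nonzero. *)
have [z [z1 z2] gz0] : exists2 z : R * R, -1 < z.1 < 1 /\ -1 < z.2 < 1 & g z != 0.
  have lc : {for (1 : R), continuous (fun h : R => g (h *: x))}.
    apply: continuous_comp; last exact: cg.
    by apply: cvgZr_tmp; exact: cvg_id.
  have n0 : nbhs (g (1 *: x)) [set w : R | w != 0].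
    by apply: open_nbhs_nbhs; split; [exact: open_neq|rewrite /= scale1r].
  have : nbhs (1 : R) (fun h => g (h *: x) != 0) := lc _ n0.
  move=> /nbhs_ballP[e /= e0 eg].
  pose t := Num.max (1 - e / 2) 0.
  have t1 : t < 1 by rewrite /t gt_max ltr01 andbT; lra.
  have t0 : 0 <= t by rewrite /t le_max lexx orbT.
  exists (t *: x).
    case: sx; rewrite /= !in_itv/= => /andP[? ?] /andP[? ?].
    by rewrite /GRing.scale/=; split; nra.
  apply: eg; rewrite /ball/= gtr0_norm ?subr_gt0//.
  have : 1 - e / 2 <= t by rewrite /t le_max lexx.
  lra.
have [r r0 rB] : exists2 r : R, 0 < r & forall y, `|y.1 - z.1| <= r -> `|y.2 - z.2| <= r ->
    ref_square y /\ g y != 0.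
  have n0 : nbhs (g z) [set w : R | w != 0].
    by apply: open_nbhs_nbhs; split => //; exact: open_neq.
  have : nbhs z (fun y => g y != 0) := cg z _ n0.
  move=> /nbhs_ballP[e /= e0 eg].
  (* The term [e / 2] keeps the closed box inside the ball where [g] does not vanish; the other
     terms keep it inside the square. *)
  pose r := Num.min (e / 2)
    (Num.min (Num.min (z.1 + 1) (1 - z.1)) (Num.min (z.2 + 1) (1 - z.2))).
  have : [/\ r <= e / 2, r <= z.1 + 1, r <= 1 - z.1, r <= z.2 + 1 & r <= 1 - z.2].
    by rewrite /r !ge_min !lexx !orbT.
  move=> [r1 r2 r3 r4 r5]; exists r.
    rewrite /r !lt_min; move: z1 z2 => /andP[? ?] /andP[? ?].
    by repeat (apply/andP; split); lra.
  move=> y yz1 yz2; split.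
    rewrite /ref_square/= !in_itv/=; move: yz1 yz2; rewrite !ler_norml.
    by move=> /andP[? ?] /andP[? ?]; split; apply/andP; split; lra.
  by apply: eg; split; rewrite /ball/= distrC; lra.
have rB' y : (`[z.1 - r, z.1 + r]%classic `*` `[z.2 - r, z.2 + r]%classic) y ->
    ref_square y /\ g y != 0.
  by move=> []; rewrite /= !in_itv/= -!ler_distl; exact: rB.
have [inj jac] : set_inj ref_square Phi /\ (forall x, ref_square x -> 0 < jacobian_det Phi x).
  by case: hPhi.
have [d d0 dB] := @box_sub_image R Phi z r r0
  (fun y By => differentiable_Phi (rB' y By).1)
  (fun y By => lt0r_neq0 (jac y (rB' y By).1))
  (sub_in2 (fun y yB => mem_set (rB' y (set_mem yB)).1) inj).
move: dB; set D := _ `*` _ => dB.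
have mD : measurable (D : set (measurableTypeR R * measurableTypeR R)).
  by apply: measurableX; exact: measurable_itv.
(* [D] lies in the image of the box, where [f] does not vanish, hence in the null set [N]; yet its
   area is [2 * d * (2 * d)]. *)
have : (leb2 D <= 0)%E.
  rewrite -N0; apply: le_measure; rewrite ?inE// => y /dB [y' /rB'[sy' gy'] <-].
  apply: fN => /= /(_ (ex_intro2 _ _ y' sy' erefl)); rewrite fE//.
  by move=> [] /eqP; rewrite mulf_eq0 orbb (negbTE gy').
rewrite leb2_setX; [|exact: measurable_itv|exact: measurable_itv].
rewrite !lebesgue_measure_itv/= !lte_fin !ltrBlDr -!addrA !ltrDl addr_gt0//.
rewrite -!EFinD -EFinM lee_fin.
have : 0 < 2 * d * (2 * d) by rewrite !mulr_gt0.
by move: (Phi z) => [p q] /=; lra.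
Qed.

End Element.

(** * The L2 projections *)

Lemma tensor_polyD (R : realType) m (c d : 'M[R]_m.+1) x :
  tensor_poly (c + d) x = tensor_poly c x + tensor_poly d x.
Proof.
rewrite /tensor_poly -big_split; apply: eq_bigr => i _ /=.
by rewrite -big_split; apply: eq_bigr => j _ /=; rewrite mxE !mulrDl.
Qed.

Lemma tensor_polyZ (R : realType) m (a : R) (c : 'M[R]_m.+1) x :
  tensor_poly (a *: c) x = a * tensor_poly c x.
Proof.
rewrite /tensor_poly mulr_sumr; apply: eq_bigr => i _.
by rewrite mulr_sumr; apply: eq_bigr => j _; rewrite mxE !mulrA.
Qed.

Lemma tensor_poly_widen (R : realType) m n (c : 'M[R]_m.+1) : (m <= n)%N ->
  exists d : 'M[R]_n.+1, tensor_poly d =1 tensor_poly c.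
Proof.
move=> mn.
exists (\matrix_(i, j) if (i < m.+1)%N && (j < m.+1)%N
                       then c (inord i) (inord j) else 0) => x.
pose H i j := c (inord i) (inord j) * x.1 ^+ i * x.2 ^+ j.
transitivity (\sum_(i < m.+1) \sum_(j < m.+1) H i j); last first.
  by apply: eq_bigr => i _; apply: eq_bigr => j _; rewrite /H !inord_val.
rewrite (big_ord_widen n.+1 (fun i => \sum_(j < m.+1) H i j)) ?ltnS//.
rewrite [RHS]big_mkcond; apply: eq_bigr => i _.
case: ifPn => im; last first.
  by rewrite big1// => j _; rewrite mxE (negbTE im)/= !mul0r.
rewrite (big_ord_widen n.+1 (fun j => H i j)) ?ltnS//.
rewrite [RHS]big_mkcond; apply: eq_bigr => j _; rewrite mxE im /=.
by case: ifP => // _; rewrite !mul0r.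
Qed.

Lemma tensor_poly_delta (R : realType) m (i j : 'I_m.+1) (x : R * R) :
  tensor_poly (delta_mx i j) x = x.1 ^+ i * x.2 ^+ j.
Proof.
rewrite /tensor_poly (bigD1 i)//= [X in _ + X]big1 ?addr0; last first.
  by move=> k /negbTE ki; rewrite big1// => l _; rewrite mxE ki/= !mul0r.
rewrite (bigD1 j)//= [X in _ + X]big1 ?addr0; last first.
  by move=> k /negbTE kj; rewrite mxE kj andbF !mul0r.
by rewrite mxE !eqxx mul1r.
Qed.

(* A solution [a] exists as soon as [b] vanishes on the kernel of [G], which
   for a Gram matrix needs no definiteness of the generating family. *)
Lemma mulmx_solvable (F : fieldType) n (G : 'M[F]_n) (b : 'rV[F]_n) :
  (forall z : 'cV[F]_n, G *m z = 0 -> b *m z = 0) -> exists a, b = a *m G.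
Proof.
(* The columns of the cokernel matrix lie in the kernel of [G], and [b] is in the row space as soon
   as it annihilates them. *)
move=> Gb; apply/submxP; rewrite submxE; apply/eqP/matrixP => i j.
have := Gb (col j (cokermx G)).
rewrite !colE mulmxA mulmx_coker mul0mx mulmxA -colE => /(_ erefl).
move=> /matrixP/(_ i 0) bj0; transitivity (col j (b *m cokermx G) i 0).
  by rewrite [RHS]mxE.
by rewrite bj0 !mxE.
Qed.

Section Projection.
Variables (R : realType) (Phi : R * R -> R * R).
Hypothesis hPhi : element_map Phi.
Implicit Types (f g v w p : R * R -> R) (m n : nat).

Let integD := integD hPhi.
Let integZ := integZ hPhi.
Let eq_integ := @eq_integ R Phi.

(** * The L2 inner product on the element and Gram systems *)

Definition inner f g : R := integ Phi (fun x => f x * g x).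

Lemma innerC f g : inner f g = inner g f.
Proof. by apply: eq_integ => x _; rewrite mulrC. Qed.

Lemma innerDl f g v : cont_pullback Phi f -> cont_pullback Phi g ->
  cont_pullback Phi v -> inner (fun x => f x + g x) v = inner f v + inner g v.
Proof.
move=> cf cg cv; rewrite -integD; [|exact: cont_pullbackM..].
by apply: eq_integ => x _; rewrite mulrDl.
Qed.

Lemma innerZl a f v : cont_pullback Phi f -> cont_pullback Phi v ->
  inner (fun x => a * f x) v = a * inner f v.
Proof.
move=> cf cv; rewrite -integZ; last exact: cont_pullbackM.
by apply: eq_integ => x _; rewrite mulrA.
Qed.

Lemma innerBl f g v : cont_pullback Phi f -> cont_pullback Phi g ->
  cont_pullback Phi v -> inner (fun x => f x - g x) v = inner f v - inner g v.
Proof.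
move=> cf cg cv; under [X in inner X _]eq_fun do rewrite -mulN1r.
rewrite innerDl//; last exact: cont_pullbackZ.
by rewrite innerZl// mulN1r.
Qed.

Lemma innerBr f g v : cont_pullback Phi f -> cont_pullback Phi g ->
  cont_pullback Phi v -> inner v (fun x => f x - g x) = inner v f - inner v g.
Proof. by move=> *; rewrite innerC innerBl// innerC (innerC g). Qed.

Lemma eq_innerl f g v : (forall x, element Phi x -> f x = g x) ->
  inner f v = inner g v.
Proof. by move=> fg; apply: eq_integ => x /fg ->. Qed.

Lemma eq_innerr f g v : (forall x, element Phi x -> f x = g x) ->
  inner v f = inner v g.
Proof. by move=> fg; rewrite innerC (eq_innerl _ fg) innerC. Qed.

Lemma inner0l f v : (forall x, element Phi x -> f x = 0) ->
  cont_pullback Phi v -> inner f v = 0.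
Proof.
move=> f0 cv; rewrite -[RHS](mul0r (inner v v)) -innerZl//.
by apply: eq_innerl => x /f0 ->; rewrite mul0r.
Qed.

Lemma cont_pullback_sum (I : Type) (r : seq I) (P : pred I) (a : I -> R)
    (f : I -> R * R -> R) : (forall i, P i -> cont_pullback Phi (f i)) ->
  cont_pullback Phi (fun x => \sum_(i <- r | P i) a i * f i x).
Proof.
move=> cf; elim: r => [|i r IHr].
  by under eq_fun do rewrite big_nil; exact: cont_pullback_cst.
have [Pi|/negbTE nPi] := boolP (P i).
  under eq_fun do rewrite big_cons Pi.
  by apply: cont_pullbackD => //; apply: cont_pullbackZ; exact: cf.
by under eq_fun do rewrite big_cons nPi.
Qed.

Lemma inner_suml (I : Type) (r : seq I) (P : pred I) (a : I -> R)
    (f : I -> R * R -> R) v :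
  (forall i, P i -> cont_pullback Phi (f i)) -> cont_pullback Phi v ->
  inner (fun x => \sum_(i <- r | P i) a i * f i x) v =
  \sum_(i <- r | P i) a i * inner (f i) v.
Proof.
move=> cf cv; elim: r => [|i r IHr].
  rewrite big_nil; under [X in inner X _]eq_fun do rewrite big_nil.
  exact: inner0l.
rewrite big_cons; case: ifPn => [Pi|/negbTE nPi].
  under [X in inner X _]eq_fun do rewrite big_cons Pi.
  rewrite innerDl//; last exact: cont_pullback_sum.
    by rewrite IHr innerZl//; exact: cf.
  by apply: cont_pullbackZ; exact: cf.
by under [X in inner X _]eq_fun do rewrite big_cons nPi.
Qed.

(** The conditions form a linear system with the Gram matrix of [e]. A kernel vector gives a
    combination orthogonal to every [e i], hence to itself, hence zero on the element; so
    [mulmx_solvable] applies. *)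
Lemma gram_projection n (e : 'I_n -> R * R -> R) w :
  (forall i, cont_pullback Phi (e i)) -> cont_pullback Phi w ->
  exists a : 'I_n -> R,
    forall j, inner (fun x => \sum_i a i * e i x) (e j) = inner w (e j).
Proof.
move=> ce cw.
have [z Gz0|a ba] := @mulmx_solvable R n (\matrix_(i, j) inner (e i) (e j))
  (\row_j inner w (e j)); last first.
  exists (a 0) => j; rewrite inner_suml//.
  move/matrixP: ba => /(_ 0 j); rewrite !mxE => ->.
  by apply: eq_bigr => i _; rewrite mxE.
pose s x := \sum_i z i 0 * e i x.
have cs : cont_pullback Phi s by exact: cont_pullback_sum.
have es i : inner (e i) s = 0.
  rewrite innerC inner_suml//; move/matrixP: Gz0 => /(_ i 0).
  rewrite !mxE => Gi; rewrite -[RHS]Gi; apply: eq_bigr => j _.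
  by rewrite mxE mulrC innerC.
have s0 : forall x, element Phi x -> s x = 0.
  apply: (integ_sqr_eq0 hPhi cs); rewrite -/(inner s s) {1}/s inner_suml//.
  by rewrite big1// => i _; rewrite es mulr0.
apply/matrixP => i j; rewrite !ord1 !mxE.
transitivity (inner s w).
  rewrite inner_suml//; apply: eq_bigr => k _.
  by rewrite !mxE mulrC (innerC w).
exact: inner0l.
Qed.

(** * The mapped polynomial spaces *)

Lemma Qspace_cont m v : Qspace Phi m v -> cont_pullback Phi v.
Proof. by move=> [_ [c vc]]; exists (tensor_poly c) => //; exact: continuous_tensor_poly. Qed.

(** A polynomial pullback is continuous, so square integrability follows and closure properties
    reduce to coefficients. *)
Lemma Qspace_coef m v (c : 'M[R]_m.+1) :
  (forall x, ref_square x -> v (Phi x) = tensor_poly c x) -> Qspace Phi m v.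
Proof.
move=> vc; split; last by exists c.
apply: cont_pullback_L2 => //; exists (tensor_poly c) => //.
exact: continuous_tensor_poly.
Qed.

Lemma QspaceD m v w : Qspace Phi m v -> Qspace Phi m w ->
  Qspace Phi m (fun x => v x + w x).
Proof.
move=> [_ [c vc]] [_ [d wd]]; apply: (@Qspace_coef _ _ (c + d)) => x sx.
by rewrite vc// wd// tensor_polyD.
Qed.

Lemma QspaceZ m a v : Qspace Phi m v -> Qspace Phi m (fun x => a * v x).
Proof.
move=> [_ [c vc]]; apply: (@Qspace_coef _ _ (a *: c)) => x sx.
by rewrite vc// tensor_polyZ.
Qed.

Lemma QspaceB m v w : Qspace Phi m v -> Qspace Phi m w ->
  Qspace Phi m (fun x => v x - w x).
Proof.
move=> Qv Qw; under eq_fun do rewrite -mulN1r.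
by apply: QspaceD => //; exact: QspaceZ.
Qed.

Lemma Qspace_cst m a : Qspace Phi m (fun=> a).
Proof.
apply: (@Qspace_coef _ _ (a *: delta_mx 0 0)) => x _.
by rewrite tensor_polyZ tensor_poly_delta !expr0 !mulr1.
Qed.

Lemma Qspace_sum m (I : eqType) (r : seq I) (a : I -> R)
    (f : I -> R * R -> R) : (forall i, i \in r -> Qspace Phi m (f i)) ->
  Qspace Phi m (fun x => \sum_(i <- r) a i * f i x).
Proof.
elim: r => [|i r IHr] Qf.
  by under eq_fun do rewrite big_nil; exact: Qspace_cst.
under eq_fun do rewrite big_cons; apply: QspaceD.
  by apply: QspaceZ; apply: Qf; rewrite mem_head.
by apply: IHr => j jr; apply: Qf; rewrite in_cons jr orbT.
Qed.

Lemma Qspace_widen m n v : (m <= n)%N -> Qspace Phi m v -> Qspace Phi n v.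
Proof.
move=> mn [_ [c vc]]; have [d dc] := tensor_poly_widen c mn.
by apply: (@Qspace_coef _ _ d) => x sx; rewrite dc vc.
Qed.

(** * Existence, uniqueness and symmetry of the projections *)

Lemma is_L2proj_inner m w p : cont_pullback Phi w -> is_L2proj Phi m w p ->
  forall v, Qspace Phi m v -> inner p v = inner w v.
Proof.
move=> cw [Qp pw] v Qv; apply/eqP; rewrite -subr_eq0 -innerBl//.
- by apply/eqP; exact: pw.
- exact: Qspace_cont Qp.
- exact: Qspace_cont Qv.
Qed.

(** Monomials composed with an inverse of [Phi] form a finite family spanning the space on the
    element, so orthogonality to this family suffices. *)
Lemma is_L2proj_exists m w : cont_pullback Phi w ->
  exists p, is_L2proj Phi m w p.
Proof.
move=> cw; have inj : set_inj ref_square Phi by case: hPhi.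
pose psi := 'pinv_(fun=> 0) ref_square Phi.
have psiK x : ref_square x -> psi (Phi x) = x.
  by move=> sx; apply: pinvKV => //; rewrite inE.
pose mono (ij : 'I_m.+1 * 'I_m.+1) y := (psi y).1 ^+ ij.1 * (psi y).2 ^+ ij.2.
have Qmono ij : Qspace Phi m (mono ij).
  apply: (@Qspace_coef _ _ (delta_mx ij.1 ij.2)) => x sx.
  by rewrite tensor_poly_delta /mono psiK.
have cmono ij := Qspace_cont (Qmono ij).
have [a orth] := @gram_projection #|{: 'I_m.+1 * 'I_m.+1}|
  (fun k => mono (enum_val k)) w (fun k => cmono _) cw.
pose p x := \sum_k a k * mono (enum_val k) x.
have Qp : Qspace Phi m p by apply: Qspace_sum.
have cp := Qspace_cont Qp.
exists p; split => // v [_ [c vc]].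
have cpw : cont_pullback Phi (fun x => p x - w x) by exact: cont_pullbackB.
transitivity (inner (fun x => \sum_ij c ij.1 ij.2 * mono ij x)
                    (fun x => p x - w x)).
  rewrite innerC; apply: eq_innerr => _ [x sx <-]; rewrite vc//.
  rewrite /tensor_poly pair_bigA; apply: eq_bigr => ij _ /=.
  by rewrite /mono psiK// mulrA.
rewrite inner_suml// big1// => ij _; rewrite innerC innerBl//.
by rewrite -(enum_rankK ij) orth subrr mulr0.
Qed.

Lemma L2projP m w : cont_pullback Phi w -> is_L2proj Phi m w (L2proj Phi m w).
Proof. by move=> /(is_L2proj_exists m); exact: xgetPex. Qed.

Lemma L2proj_Qspace m w : cont_pullback Phi w -> Qspace Phi m (L2proj Phi m w).
Proof. by move=> /(L2projP m)[]. Qed.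

Lemma L2proj_cont m w : cont_pullback Phi w -> cont_pullback Phi (L2proj Phi m w).
Proof. by move=> /(L2proj_Qspace m)/Qspace_cont. Qed.

Lemma L2proj_inner m w v : cont_pullback Phi w -> Qspace Phi m v ->
  inner (L2proj Phi m w) v = inner w v.
Proof. by move=> cw; apply: is_L2proj_inner => //; exact: L2projP. Qed.

(** The difference [v - w] is itself a test function; its norm is then zero, so it vanishes at every
    point of the element. *)
Lemma Qspace_inner_eq m v w : Qspace Phi m v -> Qspace Phi m w ->
  (forall z, Qspace Phi m z -> inner v z = inner w z) ->
  forall x, element Phi x -> v x = w x.
Proof.
move=> Qv Qw vw x ex; have Qd := QspaceB Qv Qw.
apply/eqP; rewrite -subr_eq0; apply/eqP.
apply: (integ_sqr_eq0 hPhi (Qspace_cont Qd)) ex.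
rewrite -/(inner _ (fun x => v x - w x)) innerBl ?vw ?subrr//.
- exact: Qspace_cont Qv.
- exact: Qspace_cont Qw.
- exact: Qspace_cont Qd.
Qed.

Lemma L2proj_id m v : Qspace Phi m v ->
  forall x, element Phi x -> L2proj Phi m v x = v x.
Proof.
move=> Qv; have cv := Qspace_cont Qv.
apply: (@Qspace_inner_eq m) => //; first exact: L2proj_Qspace.
by move=> z Qz; exact: L2proj_inner.
Qed.

Lemma L2proj_selfadjoint m v w : cont_pullback Phi v -> cont_pullback Phi w ->
  inner v (L2proj Phi m w) = inner (L2proj Phi m v) w.
Proof.
move=> cv cw; rewrite -(@L2proj_inner m v)//; last exact: L2proj_Qspace.
by rewrite innerC L2proj_inner//; [rewrite innerC|exact: L2proj_Qspace].
Qed.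

(** Index [0] gives the projection itself, not the zero increment that the convention P^(-1) = P^0
    would produce, so that the modes telescope to a projection. *)
Definition mode k w : R * R -> R :=
  if k is j.+1 then fun x => L2proj Phi j.+1 w x - L2proj Phi j w x
  else L2proj Phi 0 w.

Lemma mode_Qspace k w : cont_pullback Phi w -> Qspace Phi k (mode k w).
Proof.
move=> cw; case: k => [|k]; first exact: L2proj_Qspace.
apply: QspaceB; first exact: L2proj_Qspace.
by apply: (@Qspace_widen k) => //; exact: L2proj_Qspace.
Qed.

Lemma mode_cont k w : cont_pullback Phi w -> cont_pullback Phi (mode k w).
Proof. by move=> /(mode_Qspace k)/Qspace_cont. Qed.

Lemma mode_selfadjoint k v w : cont_pullback Phi v -> cont_pullback Phi w ->
  inner v (mode k w) = inner (mode k v) w.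
Proof.
move=> cv cw; case: k => [|k]; first exact: L2proj_selfadjoint.
have cpw j := L2proj_cont j cw; have cpv j := L2proj_cont j cv.
by rewrite /mode innerBr// innerBl// !L2proj_selfadjoint.
Qed.

Lemma sum_mode n w x : \sum_(0 <= k < n.+1) mode k w x = L2proj Phi n w x.
Proof.
elim: n => [|n IHn]; first by rewrite big_nat1.
by rewrite big_nat_recr//= IHn addrC subrK.
Qed.

(** The residual is orthogonal to the space of index [m], which contains the mode when [k <= m]. *)
Lemma inner_mode_high k m v w : (k <= m)%N ->
  cont_pullback Phi v -> cont_pullback Phi w ->
  inner (fun x => v x - L2proj Phi m v x) (mode k w) = 0.
Proof.
move=> km cv cw; have cpv := L2proj_cont m cv; have cmw := mode_cont k cw.
rewrite innerBl// L2proj_inner ?subrr//.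
by apply: Qspace_widen km _; exact: mode_Qspace.
Qed.

(** The projection of [v] lies in the spaces of index [k] and [k.+1], so both projections of [w]
    have the same product with it and their difference is orthogonal to it. *)
Lemma inner_mode_low k m v w : (m <= k)%N ->
  cont_pullback Phi v -> cont_pullback Phi w ->
  inner (fun x => v x - L2proj Phi m v x) (mode k.+1 w) =
  inner v (mode k.+1 w).
Proof.
move=> mk cv cw; have cpv := L2proj_cont m cv.
have cmw := mode_cont k.+1 cw; have cpw j := L2proj_cont j cw.
have Qpv j : (m <= j)%N -> Qspace Phi j (L2proj Phi m v).
  by move=> mj; apply: Qspace_widen mj _; exact: L2proj_Qspace.
rewrite innerBl// [X in _ - X](_ : _ = 0) ?subr0//.
rewrite innerC innerBl// !L2proj_inner ?subrr//; apply: Qpv => //.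
exact: leqW.
Qed.

End Projection.

(** * The damped evolution *)

Section Evolution.
Variables (R : realType) (Phi : R * R -> R * R).
Hypothesis hPhi : element_map Phi.
Variables (N : nat) (delta : nat -> R) (u : R * R -> R) (us : R -> R * R -> R).
Hypothesis Qu : Qspace Phi N u.
Hypothesis hus : is_damping_solution Phi N delta u us.

Let cu : cont_pullback Phi u := Qspace_cont Qu.

(** Mode [0] is the conserved part, so its rate is [0] rather than [delta 0]. *)
Definition mode_rate k : R :=
  if k is 0 then 0 else \sum_(0 <= m < k.+1) delta m.

Lemma damping_solution_Qspace t : 0 <= t -> Qspace Phi N (us t).
Proof. by case: hus => + _ _; exact. Qed.

(** The premise makes [v] act as an eigenvector of the damping form along the solution, which turns
    the weak equation tested with [v] into a scalar linear one. *)
Lemma damping_solution_decay v (l : R) : Qspace Phi N v ->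
  (forall t, 0 <= t -> \sum_(0 <= m < N.+1) delta m *
     inner Phi (fun x => us t x - L2proj Phi m.-1 (us t) x) v =
     l * inner Phi (us t) v) ->
  forall t, 0 <= t -> inner Phi (us t) v = expR (- (t * l)) * inner Phi u v.
Proof.
move=> Qv sumE t t0; case: hus => _ dus us0.
rewrite -(eq_innerl v us0).
apply: (@halfline_linear_ode _ (fun s => inner Phi (us s) v)) t0 => {}t t0.
have [d dF] := dus v Qv t t0.
rewrite -/(inner _ _ _) => dsum; suff <- : d = - l * inner Phi (us t) v by [].
by apply/eqP; rewrite mulNr -addr_eq0 -(sumE t t0); apply/eqP.
Qed.

Lemma mode_decay k w t : (k <= N)%N -> cont_pullback Phi w -> 0 <= t ->
  inner Phi (us t) (mode Phi k w) =
  expR (- (t * mode_rate k)) * inner Phi u (mode Phi k w).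
Proof.
move=> kN cw; move: t; apply: damping_solution_decay.
  by apply: (Qspace_widen hPhi kN); exact: mode_Qspace.
move=> t t0; have cus := Qspace_cont (damping_solution_Qspace t0).
case: k kN => [|k] kN.
  rewrite mul0r big1_seq// => m _.
  by rewrite (@inner_mode_high _ _ hPhi 0)// mulr0.
(* For [m <= k.+1] the projection has index [m.-1 <= k] and the full product remains; from
   [m = k.+2] on, [m.-1] is at least [k.+1] and the term vanishes. *)
set v := mode Phi k.+1 w; rewrite (@big_cat_nat _ _ _ k.+2)//=.
rewrite [X in _ + X]big_nat [X in _ + X]big1; last first.
  move=> m /andP[km _]; rewrite /v inner_mode_high ?mulr0//.
  by case: m km.
rewrite addr0 mulr_suml big_nat [RHS]big_nat; apply: eq_bigr => m /andP[_ mk].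
by rewrite /v inner_mode_low//; case: m mk.
Qed.

(** Such a [v] lies in all the spaces, so every damping term vanishes and the rate is [0]. Both the
    degree-zero projection and the cell average are determined by such tests. *)
Lemma average_decay v t : Qspace Phi 0 v -> 0 <= t ->
  inner Phi (us t) v = inner Phi u v.
Proof.
move=> Qv t0; have QNv : Qspace Phi N v by exact: (Qspace_widen hPhi _ Qv).
rewrite (@damping_solution_decay v 0)// ?mulr0 ?oppr0 ?expR0 ?mul1r//.
move=> {t0}t t0; have cus := Qspace_cont (damping_solution_Qspace t0).
rewrite mul0r big1_seq// => m _.
have Qmv : Qspace Phi m.-1 v by exact: (Qspace_widen hPhi _ Qv).
rewrite innerBl ?L2proj_inner ?subrr ?mulr0//.
  exact: L2proj_cont.
exact: Qspace_cont Qv.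
Qed.

(* Both sides are tested against [v]: expanding [v] in its modes gives the
   left-hand side, moving the modes onto [u] the right-hand side. *)
Lemma damping_solution_modes t : 0 <= t -> forall x, element Phi x ->
  us t x = \sum_(0 <= k < N.+1) expR (- (t * mode_rate k)) * mode Phi k u x.
Proof.
move=> t0; have Qus := damping_solution_Qspace t0.
apply: (Qspace_inner_eq hPhi Qus).
  apply: Qspace_sum => // k; rewrite mem_index_iota ltnS => /andP[_ kN].
  by apply: (Qspace_widen hPhi kN); exact: mode_Qspace.
move=> v Qv; have cv := Qspace_cont Qv; have cus := Qspace_cont Qus.
rewrite inner_suml//; last by move=> k _; exact: mode_cont.
transitivity (inner Phi (us t) (fun x => \sum_(0 <= k < N.+1) 1 * mode Phi k v x)).
  apply: eq_innerr => x ex; under eq_bigr do rewrite mul1r.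
  by rewrite sum_mode L2proj_id.
rewrite innerC inner_suml//; last by move=> k _; exact: mode_cont.
rewrite big_nat [RHS]big_nat; apply: eq_bigr => k /andP[_]; rewrite ltnS => kN.
by rewrite mul1r innerC mode_decay// mode_selfadjoint.
Qed.

End Evolution.

(** * The closed formula and conservation of the average *)

Theorem mainTheorem3 (R : realType) (Phi : R * R -> R * R)
    (hPhi : element_map Phi) (N : nat) (hN : (1 <= N)%N)
    (delta : nat -> R) (hdelta : forall m : nat, (m <= N)%N -> 0 <= delta m)
    (u : R * R -> R) (hu : Qspace Phi N u)
    (us : R -> R * R -> R) (hus : is_damping_solution Phi N delta u us)
    (dt : R) (hdt : 0 <= dt) :
  [/\ forall x, element Phi x ->
        us dt x = L2proj Phi 0 u x +
          \sum_(1 <= k < N.+1)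
            expR (- (dt * \sum_(0 <= m < k.+1) delta m)) *
              (L2proj Phi k u x - L2proj Phi k.-1 u x),
      forall x, element Phi x -> L2proj Phi 0 (us dt) x = L2proj Phi 0 u x
    & cell_average Phi (us dt) = cell_average Phi u].
Proof.
have cu := Qspace_cont hu.
have cus := Qspace_cont (damping_solution_Qspace hus hdt).
split.
- move=> x ex; rewrite (damping_solution_modes hPhi hu hus hdt ex).
  (* The term [k = 0] has rate [0] and splits off; the modes [k.+1] then match the sum starting at
     [1]. *)
  rewrite big_nat_recl// mulr0 oppr0 expR0 mul1r; congr (_ + _).
  by rewrite big_add1.
- apply: (@Qspace_inner_eq _ _ hPhi 0); [exact: L2proj_Qspace..|] => v Qv.
  by rewrite !L2proj_inner//; exact: (average_decay hPhi hus Qv hdt).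
- rewrite /cell_average; congr (_ / _).
  (* The integral is the product with the constant [1], a test function of degree [0]. *)
  have int1 f : integ Phi f = inner Phi f (fun=> 1).
    by apply: eq_integ => x _; rewrite mulr1.
  rewrite !int1; apply: (average_decay hPhi hus) hdt.
  exact: Qspace_cst.
Qed.
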